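(* Let $X$ be an ordered Banach space with cone $K$, and for $\phi\in X'$ define $$p_\phi(x)=\inf\{\langle y,\phi\rangle : y\in X,\ y\ge 0,\ y\ge x\},\qquad x\in X.$$ Let $A\colon X\supseteq\mathcal{D}(A)\to X$ be the generator of a strongly continuous semigroup $(T(t))_{t\ge 0}$ on $X$. If there is a total set $\Phi\subseteq K'$ such that $A$ is $p_\phi$-dissipative for all $\phi\in\Phi$, and $I-\lambda A$ is invertible for some $\lambda\ge 0$, then $T(t)$ is positive for all $t\ge 0$.
   Context: All vector spaces are real. A subset $K$ of a vector space $X$ is a cone if $\lambda x+\mu y\in K$ for all $x,y\in K$ and $\lambda,\mu\ge 0$, and $K\cap(-K)=\{0\}$. It induces the partial order $x\le y$ iff $y-x\in K$. An ordered Banach space is a Banach space $X$ equipped with the partial order induced by a cone $K$. $X'$ denotes the continuous linear functionals on $X$, $\langle x,\phi\rangle=\phi(x)$, and $K'$ denotes the set of positive functionals in $X'$, i.e. those $x'\in X'$ with $\langle x,x'\rangle\ge 0$ for all $x\in K$. A nonempty subset $\Phi\subseteq K'$ is total in $X$ if, for $x\in X$, $\phi(x)\ge 0$ for each $\phi\in\Phi$ implies $x\ge 0$. Operators are linear, with domain $\mathcal{D}(A)$, a linear subspace of $X$. Invertibility of $I-\lambda A$ means that $I-\lambda A\colon\mathcal{D}(A)\to X$ is bijective with bounded inverse on $X$. A bounded operator $T$ on $X$ is positive if $Tx\ge 0$ for all $x\ge 0$. For a function $p$ on $X$ and $x\in X$, the subdifferential is $$dp(x)=\{x'\in K' : \langle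 y,x'\rangle\le p(y)\text{ for all }y\in X,\ \langle x,x'\rangle=p(x)\}.$$ An operator $A\colon\mathcal{D}(A)\subseteq X\to X$ is $p$-dissipative if for every $x\in\mathcal{D}(A)$ there exists $y'\in dp(x)$ with $\langle Ax,y'\rangle\le 0$. *)

(* Defs.v *)
From HB Require Import structures.
From mathcomp Require Import all_boot all_order all_algebra.
From mathcomp Require Import all_classical all_reals all_analysis.

Set Implicit Arguments.
Unset Strict Implicit.
Unset Printing Implicit Defensive.

Import Order.TTheory GRing.Theory Num.Theory.
Import numFieldNormedType.Exports.

Local Open Scope classical_set_scope.
Local Open Scope ring_scope.

Section OrderedBanach.
Context {R : realType} {X : completeNormedModType R}.
Implicit Types (K : set X) (p : X -> \bar R) (T : R -> {linear X -> X}).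

Definition is_cone K : Prop :=
  (forall (x y : X) (a b : R),
     K x -> K y -> 0 <= a -> 0 <= b -> K (a *: x + b *: y)) /\
  K `&` [set x | K (- x)] = [set 0].

Definition cone_le K (x y : X) : Prop := K (y - x).

Definition topological_dual : set {linear X -> R^o} :=
  [set phi | continuous (phi : X -> R^o)].

(* K', as a subset of X'. *)
Definition dual_cone K : set {linear X -> R^o} :=
  topological_dual `&` [set phi | forall x, cone_le K 0 x -> 0 <= (phi x : R)].

Definition total_functionals K (Phi : set {linear X -> R^o}) : Prop :=
  [/\ Phi !=set0, Phi `<=` dual_cone K &
   forall x : X, (forall phi, Phi phi -> 0 <= (phi x : R)) -> cone_le K 0 x].

(* The infimum is taken in the extended reals: it is +oo when x has no
   positive upper bound, i.e. when x lies outside K - K. *)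
Definition p_fun K (phi : {linear X -> R^o}) (x : X) : \bar R :=
  ereal_inf [set (phi y : R)%:E | y in [set y | cone_le K 0 y /\ cone_le K x y]].

Definition subdifferential K p (x : X) : set {linear X -> R^o} :=
  [set phi | [/\ dual_cone K phi,
               forall y : X, ((phi y : R)%:E <= p y)%E &
               (phi x : R)%:E = p x]].

(* A linear map on a subspace; the values of [op_fun] outside [op_dom] are
   irrelevant. *)
Record operator := Operator {
  op_dom : set X ;
  op_fun :> X -> X ;
  op_dom0 : op_dom 0 ;
  op_domP : forall (a : R) (x y : X),
    op_dom x -> op_dom y -> op_dom (a *: x + y) ;
  op_linear : forall (a : R) (x y : X),
    op_dom x -> op_dom y -> op_fun (a *: x + y) = a *: op_fun x + op_fun y
}.

Definition dissipative K p (A : operator) : Prop :=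
  forall x : X, op_dom A x ->
    exists2 phi : {linear X -> R^o},
      subdifferential K p x phi & (phi (A x) : R) <= 0.

Definition bounded_op (S : {linear X -> X}) : Prop :=
  exists M : R, forall x : X, `|S x| <= M * `|x|.

(* [S] is the inverse of I - lambda A : D(A) -> X; its existence as a two-sided
   inverse expresses bijectivity. *)
Definition invertible_id_sub (A : operator) (lambda : R) : Prop :=
  exists S : {linear X -> X},
    [/\ bounded_op S,
        forall x : X, op_dom A x -> S (x - lambda *: A x) = x &
        forall y : X, op_dom A (S y) /\ S y - lambda *: A (S y) = y].

Definition positive_op K (S : {linear X -> X}) : Prop :=
  forall x : X, cone_le K 0 x -> cone_le K 0 (S x).

(* Only the values T t with t >= 0 are meaningful. *)
Definition C0_semigroup T : Prop :=
  [/\ forall t : R, 0 <= t -> bounded_op (T t),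
      forall x : X, T 0 x = x,
      forall (s t : R) (x : X), 0 <= s -> 0 <= t -> T (s + t) x = T s (T t x) &
      forall x : X, {within `[0, +oo[, continuous (fun t : R => T t x)}].

Definition is_generator (A : operator) T : Prop :=
  let quot (x : X) (h : R) : X := h^-1 *: (T h x - x) in
  op_dom A = [set x | cvg (quot x h @[h --> (0 : R)^'+])] /\
  forall x : X, op_dom A x -> quot x h @[h --> (0 : R)^'+] --> A x.

End OrderedBanach.

Arguments operator {R} X.

(* Main.v *)
Require Import Defs.
From HB Require Import structures.
From mathcomp Require Import all_boot all_order all_algebra.
From mathcomp Require Import all_classical all_reals all_analysis.
From mathcomp Require Import lra ring.

Set Implicit Arguments.
Unset Strict Implicit.
Unset Printing Implicit Defensive.

Import Order.TTheory GRing.Theory Num.Theory.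
Import numFieldNormedType.Exports.

Local Open Scope classical_set_scope.
Local Open Scope ring_scope.

(** The cone inequality passes from the functionals [Phi] to resolvents, and
    from resolvents to the semigroup.

    Resolvents.  Let [x] be in the domain of [A] with [a x - b A x >= 0] for
    some [a > 0], [b >= 0].  For [phi] in [Phi], dissipativity at [- x] gives a
    positive functional [psi] with [psi (- x) = p_phi (- x)] and
    [psi (A x) >= 0].  Then [a psi x >= b psi (A x) >= 0], so
    [phi (- x) <= p_phi (- x) = psi (- x) <= 0].  As [Phi] is total, [x >= 0]
    ([dissipative_positive]).  Hence the implicit Euler step
    [(I - h A)^-1] maps the cone into itself whenever it exists.

    Semigroup.  [T] is bounded by [M exp (w t)], by the uniform boundedness
    principle.  In the equivalent norm
    [N x = sup_(t >= 0) exp (- w t) |T t x|] the rescaled semigroup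
    [S t = exp (- w t) T t] consists of contractions
    ([adapted_norm_exists]), and its generator [B = A - w] satisfies
    [N x <= N (x - h B x)] ([generator_dissipative]).  This makes the implicit
    Euler scheme stable, so that its iterates converge to [S t x] for [x] in the
    domain ([euler_error]), and for every [x] by density.  They stay in the
    cone, which is closed because it is the intersection of the half-spaces
    [phi >= 0] ([total_closed]); therefore [S t x] is in the cone
    ([resolvent_invariant]).

    Existence of the resolvents and density of the domain would usually be read
    off the vector-valued integral of [G s x], where [G s = exp (- d s) S s].
    Here that integral is the limit of its Riemann sums over the whole half-line
    with mesh [h = 2 ^- n].  Such a sum is a geometric series, hence the
    solution [y] of [y - G h y = h x]; this equation carries all the estimates
    ([discrete_resolvent_iter], [discrete_resolvent_refine],
    [discrete_resolvent_limit]). *)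

Section Semigroups.
Context {R : realType} {X : completeNormedModType R}.
Implicit Types (N : X -> R) (S : R -> {linear X -> X}) (x y z : X).

(** * Semigroups adapted to an equivalent norm *)

(** A real function rather than a second normed-module structure, so that
    convergence and completeness are always those of [X]. *)
Record equivalent_norm N : Prop := EquivalentNorm {
  eqn_triangle : forall x y, N (x + y) <= N x + N y ;
  eqn_scale : forall (a : R) x, N (a *: x) = `|a| * N x ;
  eqn_ge : forall x, `|x| <= N x ;
  eqn_le : exists2 M : R, 0 < M & forall x, N x <= M * `|x|
}.

(** The constant [M] of a bound [M exp (omega t)] is absorbed in [N]: with the
    constant 1 the bound can be iterated without loss. *)
Record adapted_semigroup N (omega : R) S : Prop := AdaptedSemigroup {
  sg0 : forall x, S 0 x = x ;
  sgD : forall (s t : R) x, 0 <= s -> 0 <= t -> S (s + t) x = S s (S t x) ;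
  sg_cvg0 : forall x, S s x @[s --> (0 : R)^'+] --> x ;
  sg_growth : forall (t : R) x, 0 <= t -> N (S t x) <= expR (omega * t) * N x
}.

(** The graph of the generator. As a relation it needs no operator with a
    domain for each of the rescaled semigroups. *)
Definition generator_rel S x y : Prop :=
  h^-1 *: (S h x - x) @[h --> (0 : R)^'+] --> y.

Definition rescale (a : R) S : R -> {linear X -> X} :=
  fun t => (expR (- a * t) \*: S t : {linear X -> X}).

Section Norm.
Context {N : X -> R} (hN : equivalent_norm N).

Lemma eqn0 : N 0 = 0.
Proof. by rewrite -(scale0r 0) (eqn_scale hN) normr0 mul0r. Qed.

Lemma eqnN x : N (- x) = N x.
Proof. by rewrite -scaleN1r (eqn_scale hN) normrN1 mul1r. Qed.

Lemma eqn_triangleB x y : N (x - y) <= N x + N y.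
Proof. by rewrite -(eqnN y) (eqn_triangle hN). Qed.

Lemma eqn_ge0 x : 0 <= N x.
Proof. exact: le_trans (normr_ge0 x) (eqn_ge hN x). Qed.

Lemma eqnZ (a : R) x : 0 <= a -> N (a *: x) = a * N x.
Proof. by move=> a0; rewrite (eqn_scale hN) ger0_norm. Qed.

Lemma eqn_near {T : Type} {F : set_system T} {FF : Filter F} (f : T -> X) y
  (e : R) : 0 < e -> f @ F --> y -> \forall t \near F, N (f t - y) <= e.
Proof.
move=> e0 fy; have [M M0 NM] := eqn_le hN.
move/cvgrPdist_le : fy => /(_ (e / M) (divr_gt0 e0 M0)); apply: filterS => t.
by rewrite distrC ler_pdivlMr// mulrC => /(le_trans (NM _)).
Qed.

End Norm.

Section Adapted.
Context {N : X -> R} {omega : R} {S : R -> {linear X -> X}}.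
Context (hN : equivalent_norm N) (hS : adapted_semigroup N omega S).

Lemma sg_continuous (t : R) : 0 <= t -> continuous (S t).
Proof.
move=> t0 x; have [M M0 NM] := eqn_le hN.
have C0 : 0 < expR (omega * t) * M by rewrite mulr_gt0 ?expR_gt0.
apply/cvgrPdist_le => e e0.
have : \forall y \near x, `|x - y| <= e / (expR (omega * t) * M).
  by apply: cvgr_dist_le; [exact: cvg_id|exact: divr_gt0].
apply: filterS => y; rewrite ler_pdivlMr// mulrC => xy.
rewrite -linearB; apply: le_trans (eqn_ge hN _) _.
apply: le_trans (sg_growth hS _ t0) (le_trans _ xy).
by rewrite -mulrA ler_pM2l ?expR_gt0.
Qed.

Lemma generator_linear (a : R) x x' y y' :
  generator_rel S x y -> generator_rel S x' y' ->
  generator_rel S (a *: x + x') (a *: y + y').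
Proof.
rewrite /generator_rel => gx gx'.
apply: cvg_trans (cvgD (cvgZl_tmp (k := a) gx) gx').
apply: near_eq_cvg; near=> h.
change (a *: (h^-1 *: (S h x - x)) + h^-1 *: (S h x' - x') =
  h^-1 *: (S h (a *: x + x') - (a *: x + x'))).
rewrite linearP scalerA mulrC -scalerA -scalerDr; congr (_ *: _).
by rewrite scalerBr addrACA opprD.
Unshelve. all: by end_near. Qed.

(** [S t] commutes with the difference quotients and is continuous. *)
Lemma generator_orbit (t : R) x y :
  0 <= t -> generator_rel S x y -> generator_rel S (S t x) (S t y).
Proof.
move=> t0 gx; have := cvg_comp _ _ gx (@sg_continuous t t0 y).
apply: cvg_trans; apply: near_eq_cvg; near=> h.
have h0 : 0 <= h by near: h; exact: nbhs_right_ge.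
by rewrite /= linearZ linearB/= -!(sgD hS)// [h + t]addrC.
Unshelve. all: by end_near. Qed.

End Adapted.

(** * Exponential rescaling *)

Lemma cvg_expR_slope (a : R) :
  h^-1 * (expR (a * h) - 1) @[h --> (0 : R)^'+] --> a.
Proof.
have d : is_derive (0 : R) 1 (expR \o ( *%R a)) (expR (a * 0) * a).
  apply: is_derive1_comp.
  rewrite -[X in is_derive _ _ _ X]mulr1.
  exact: (is_deriveZ a (is_derive_id (0 : R) (1 : R))).
have /cvg_dnbhs_at_right :
    h^-1 *: (expR (a * (h *: 1 + 0)) - expR (a * 0)) @[h --> (0 : R)^'] --> a.
  have := @ex_derive _ _ _ _ _ _ _ d; have := @derive_val _ _ _ _ _ _ _ d.
  rewrite /derivable /derive /comp /= mulr0 expR0 mul1r => Ha Hc.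
  by rewrite -[X in _ --> X]Ha; exact: Hc.
apply: cvg_trans; apply: near_eq_cvg; near=> h.
by rewrite /= mulr0 expR0 addr0 /GRing.scale/= mulr1.
Unshelve. all: by end_near. Qed.

Lemma cvg_expR0 (a : R) : expR (a * h) @[h --> (0 : R)^'+] --> (1 : R).
Proof.
have /cvg_at_right_filter : {for 0, continuous (fun h : R => expR (a * h))}.
  apply: continuous_comp; last exact: continuous_expR.
  exact: mulrl_continuous.
by rewrite mulr0 expR0.
Qed.

Lemma generator_rescale (a : R) S x y :
  generator_rel S x y -> generator_rel (rescale a S) x (y - a *: x).
Proof.
rewrite /generator_rel => gx.
have H : expR (- a * h) *: (h^-1 *: (S h x - x)) +
  (h^-1 * (expR (- a * h) - 1)) *: x @[h --> (0 : R)^'+] --> 1 *: y + - a *: x.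
  apply: cvgD; first exact: cvgZ (@cvg_expR0 (- a)) gx.
  exact: cvgZr_tmp (@cvg_expR_slope (- a)).
move: H; rewrite scale1r scaleNr; apply: cvg_trans.
apply: near_eq_cvg; near=> h.
change (expR (- a * h) *: (h^-1 *: (S h x - x)) +
  (h^-1 * (expR (- a * h) - 1)) *: x = h^-1 *: (expR (- a * h) *: S h x - x)).
rewrite scalerA mulrC -!scalerA -scalerDr scalerBr scalerBl scale1r.
by rewrite addrA subrK.
Unshelve. all: by end_near. Qed.

Lemma generator_unrescale (a : R) S x y :
  generator_rel (rescale a S) x y -> generator_rel S x (y + a *: x).
Proof.
move=> /(generator_rescale (a := - a)); rewrite scaleNr opprK {1}/generator_rel.
under eq_fun do rewrite /rescale/= scalerA -expRD -mulrDl addNr mul0r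
  expR0 scale1r.
exact.
Qed.

Lemma rescale_adapted (a : R) N omega S : equivalent_norm N ->
  adapted_semigroup N omega S ->
  adapted_semigroup N (omega - a) (rescale a S).
Proof.
move=> hN hS; split => [x|s t x s0 t0|x|t x t0].
- by rewrite /rescale /= mulr0 expR0 (sg0 hS) /= scale1r.
- rewrite /rescale /= (sgD hS)// linearZ/= scalerA -expRD.
  by rewrite -mulrDr.
- rewrite /rescale /= -[X in _ --> X]scale1r.
  exact: cvgZ (@cvg_expR0 (- a)) (sg_cvg0 hS (x:=x)).
- rewrite /rescale /= (eqnZ hN) ?expR_ge0// addrC mulrDl expRD -mulrA.
  by rewrite ler_pM2l ?expR_gt0// (sg_growth hS).
Qed.

(** * The implicit Euler scheme for a contraction semigroup *)

Section Contraction.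
Context {N : X -> R} {S : R -> {linear X -> X}}.
Context (hN : equivalent_norm N) (hS : adapted_semigroup N 0 S).

Lemma contraction t x : 0 <= t -> N (S t x) <= N x.
Proof. by move=> /(sg_growth hS x); rewrite mul0r expR0 mul1r. Qed.

(** The easy half of the Lumer-Phillips theorem. For the difference quotient [q]
    at step [h] instead of [y], [(1 + l / h) x = (x - l q) + (l / h) S h x], and
    [S h] is a contraction; then [h] tends to 0. *)
Lemma generator_dissipative (l : R) x y :
  0 <= l -> generator_rel S x y -> N x <= N (x - l *: y).
Proof.
move=> l0 gx; apply/ler_addgt0Pr => e e0.
have l1 : 0 < l + 1 by lra.
have /(eqn_near hN (divr_gt0 e0 l1)) qy := gx.
near (0 : R)^'+ => h.
have h0 : 0 < h by near: h; exact: nbhs_right_gt.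
have : N (h^-1 *: (S h x - x) - y) <= e / (l + 1) by near: h.
set q := h^-1 *: _; rewrite ler_pdivlMr// => qye.
have xq : N x <= N (x - l *: q).
  have lh : 0 <= l / h by rewrite divr_ge0// ltW.
  have : N ((1 + l / h) *: x) <= N (x - l *: q) + N ((l / h) *: S h x).
    apply: le_trans (eqn_triangle hN _ _); rewrite /q scalerA scalerBr.
    by rewrite opprB addrA addrNK scalerDl scale1r addrC.
  rewrite !(eqnZ hN)//; last lra.
  have := ler_wpM2l lh (contraction x (ltW h0)); lra.
apply: (le_trans xq).
have -> : x - l *: q = (x - l *: y) - l *: (q - y).
  by rewrite scalerBr opprB addrA subrK.
apply: le_trans (eqn_triangleB hN _ _) _; rewrite (eqnZ hN)// lerD2l.
by have := eqn_ge0 hN (q - y); nra.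
Unshelve. all: by end_near. Qed.

(** The orbit of [x] solves the Euler recursion up to a residual, which is
    [h S (n h)] applied to [h^-1 (S h x - x) - S h y]. By dissipativity one
    implicit step does not increase the error, so the residuals only add up.
    Since [y] is the value of the generator at [x], the last factor tends to 0
    with [h]. *)
Lemma euler_error (h : R) (v : nat -> X) x y : 0 < h -> generator_rel S x y ->
  (forall k, exists2 b, generator_rel S (v k.+1) b & v k.+1 - h *: b = v k) ->
  forall n, N (S (n%:R * h) x - v n) <=
    N (x - v 0) + n%:R * h * N (h^-1 *: (S h x - x) - S h y).
Proof.
move=> h0 gx hv; elim => [|n IHn]; first by rewrite !mul0r (sg0 hS) addr0.
set d := N (_ - S h y) in IHn *.
have nh : 0 <= n%:R * h by rewrite mulr_ge0// ltW.
have n1h : n.+1%:R * h = n%:R * h + h by rewrite -addn1 natrD mulrDl mul1r.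
have [b gb hb] := hv n.
have g1 : generator_rel S (S (n.+1%:R * h) x) (S (n.+1%:R * h) y).
  by apply: (generator_orbit hN hS) => //; rewrite n1h addr_ge0// ltW.
have := generator_linear (a := -1) gb g1.
rewrite !scaleN1r [- v _ + _]addrC [- b + _]addrC => gd.
apply: le_trans (generator_dissipative (ltW h0) gd) _.
have -> : S (n.+1%:R * h) x - v n.+1 - h *: (S (n.+1%:R * h) y - b) =
   (S (n%:R * h) x - v n) +
   h *: S (n%:R * h) (h^-1 *: (S h x - x) - S h y).
  rewrite -hb n1h !(sgD hS)// ?(ltW h0)//.
  rewrite [S _ (_ - S h y)]linearB [S _ (h^-1 *: _)]linearZ.
  rewrite [S _ (S h x - x)]linearB/=.
  move: (S (_ * h) (S h x)) (S (_ * h) x) (S (_ * h) (S h y)) => p q r.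
  rewrite !scalerBr !scalerA divff ?gt_eqF// !scale1r.
  rewrite [RHS]addrC addrACA subrK -addrA !opprB; congr (_ + _).
  by rewrite addrCA [RHS]addrCA [- _ - _]addrC.
apply: le_trans (eqn_triangle hN _ _) _; rewrite (eqnZ hN) ?(ltW h0)//.
rewrite n1h mulrDl addrA lerD// ler_pM2l//.
exact: contraction.
Qed.

End Contraction.

Lemma closed_approx N (K : set X) x : equivalent_norm N -> closed K ->
  (forall e : R, 0 < e -> exists2 y, K y & N (x - y) <= e) -> K x.
Proof.
move=> hN cK H; apply: cK => B /nbhs_ballP[e /= e0 eB].
have [y Ky xy] := H (e / 2) (divr_gt0 e0 (ltr0n _ 2)).
exists y; split=> //; apply: eB; rewrite -ball_normE /=.
by apply: (le_lt_trans (eqn_ge hN _)); apply: (le_lt_trans xy); lra.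
Qed.

(** The Euler iterates start at the given point [x] of [K] and remain in [K],
    whereas [euler_error] needs a starting point in the domain. The comparison
    is therefore with the orbit of a nearby [u] in the domain, and the distance
    from [x] to [u] is counted twice: once for the iterates, once for the
    orbits. *)
Lemma resolvent_invariant N S (K : set X) (t : R) x :
  equivalent_norm N -> adapted_semigroup N 0 S -> closed K ->
  (forall z (e : R), 0 < e ->
     exists u w, generator_rel S u w /\ N (u - z) <= e) ->
  (forall (h : R) z, 0 < h ->
     exists u w, [/\ generator_rel S u w, u - h *: w = z & (K z -> K u)]) ->
  0 <= t -> K x -> K (S t x).
Proof.
move=> hN hS cK dense res t0 Kx.
move: t0; rewrite le_eqVlt => /predU1P[<-|t0]; first by rewrite (sg0 hS).
apply: (closed_approx hN cK) => e e0.
(* The total error is at most twice the distance from [u] to [x] plus [t] times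
   the Euler residual. *)
have c0 : 0 < e / (2 + t) by rewrite divr_gt0//; lra.
have [u [w [gu ux]]] := dense x _ c0.
have : (h^-1 *: (S h u - u) - S h w) @[h --> (0 : R)^'+] --> (w - w).
  exact: cvgB gu (sg_cvg0 hS (x := w)).
move=> /(eqn_near hN c0); rewrite subrr; under eq_near do rewrite subr0.
move=> [d /= d0 hd].
(* Enough steps for the step size [t / n] to fall below [d]. *)
pose n := (Num.truncn (t / d)).+1.
pose h := t / n%:R.
have n0 : 0 < n%:R :> R by rewrite ltr0n.
have h0 : 0 < h by rewrite divr_gt0.
have hltd : h < d.
  rewrite /h ltr_pdivrMr// mulrC -ltr_pdivrMr//.
  by have /andP[] := truncn_itv (ltW (divr_gt0 t0 d0)).
have nh : n%:R * h = t by rewrite /h mulrC divfK ?gt_eqF.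
have [E hE] : {E : X -> X & forall z,
    (exists2 w, generator_rel S (E z) w & E z - h *: w = z) /\
    (K z -> K (E z))}.
  apply: (@choice _ _ (fun z y =>
    (exists2 w, generator_rel S y w & y - h *: w = z) /\ (K z -> K y))) => z.
  by have [y [b [gy yb Ky]]] := res h z h0; exists y; split => //; exists b.
pose v k := iter k E x.
have Kv k : K (v k) by elim: k => //= k /(hE (v k)).2.
exists (v n) => //.
have := euler_error hN hS h0 gu (fun k => (hE (v k)).1) n.
rewrite nh => err.
have -> : S t x - v n = (S t u - v n) - S t (u - x).
  by rewrite linearB/= opprB [RHS]addrC addrA subrK.
apply: le_trans (eqn_triangleB hN _ _) _.
have := contraction hS (u - x) (ltW t0).
have : N (h^-1 *: (S h u - u) - S h w) <= e / (2 + t).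
  by apply: hd => //=; rewrite sub0r normrN gtr0_norm.
have : (2 + t) * (e / (2 + t)) = e by rewrite mulrC divfK//; lra.
by move: err ux; nra.
Qed.

(** * Resolvents of a decaying semigroup *)

Section DecayingSemigroup.
Context {N : X -> R} {d : R} {G : R -> {linear X -> X}}.
Context (hN : equivalent_norm N) (d0 : 0 < d).
Context (hG : adapted_semigroup N (- d) G).

Lemma decay_contraction t x : 0 <= t -> N (G t x) <= N x.
Proof.
move=> t0; apply: le_trans (sg_growth hG x t0) _.
rewrite ler_piMl ?eqn_ge0// -expR0 ler_expR mulNr oppr_le0.
by rewrite mulr_ge0// ltW.
Qed.

(** [I - G h] has an inverse of norm at most [(1 - exp (- d h))^-1], and
    [exp (- d h) <= (1 + d h)^-1]. The inverse is of order [h^-1] as [h] tends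
    to 0, which is what makes the mesh sizes comparable below. *)
Lemma discrete_resolvent_bound (h : R) x : 0 <= h ->
  d * h * N x <= (1 + d * h) * N (x - G h x).
Proof.
move=> h0; have dh : 0 <= d * h by rewrite mulr_ge0// ltW.
have q1 : (1 + d * h) * expR (- d * h) <= 1.
  rewrite mulNr expRN ler_pdivrMr ?expR_gt0// mul1r.
  exact: expR_ge1Dx.
have tri : N x <= N (x - G h x) + N (G h x).
  by rewrite -{1}[x](subrK (G h x)) (eqn_triangle hN).
have := sg_growth hG x h0; have := eqn_ge0 hN x; move: q1 tri.
move: (expR _) (N (G h x)) (N (x - _)) (N x) => q a b c q1 tri c0 ac.
have : (1 + d * h) * c <= (1 + d * h) * (b + q * c).
  by rewrite ler_wpM2l//; lra.
by nra.
Qed.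

(** The solution is the geometric series of the [h G (k h) x], that is, the
    Riemann sum of mesh [h] of the integral of [G s x] over the half-line. *)
Lemma discrete_resolvent (h : R) x : 0 < h ->
  exists y, y - G h y = h *: x.
Proof.
move=> h0; pose u k := h *: G (k%:R * h) x.
pose q := expR (- d * h).
have kh k : 0 <= k%:R * h by rewrite mulr_ge0// ltW.
have q1 : `|q| < 1.
  by rewrite ger0_norm ?expR_ge0// expR_lt1 mulNr oppr_lt0 mulr_gt0.
have ub k : `|u k| <= geometric (h * N x) q k.
  apply: le_trans (eqn_ge hN _) _; rewrite (eqnZ hN) ?(ltW h0)// /=.
  rewrite -mulrA ler_pM2l//; apply: le_trans (sg_growth hG x (kh k)) _.
  by rewrite /q mulrC -expRM_natr -mulrA [h * _]mulrC.
have cu : cvgn (series u).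
  apply: normed_cvg; apply: series_le_cvg (is_cvg_geometric_series q1) => n.
  - exact: normr_ge0.
  - exact: (le_trans (normr_ge0 _) (ub n)).
  - exact: ub.
pose y := limn (series u); exists y.
(* The last term [u n] corrects for the truncation: it makes the identity exact
   and vanishes in the limit. *)
have Gs n : series u n - G h (series u n) + u n = h *: x.
  elim: n => [|n IHn].
    rewrite /series/= big_geq// linear0 subr0 add0r /u mul0r.
    by rewrite (sg0 hG).
  rewrite -[RHS]IHn /series/= big_nat_recr//= linearD/= opprD.
  have -> : G h (u n) = u n.+1.
    rewrite /u linearZ/= -(sgD hG) ?(ltW h0)//; congr (_ *: G _ _).
    by rewrite -addn1 natrD mulrDl mul1r addrC.
  by rewrite addrACA -[LHS]addrA subrK.
have u0 : u n @[n --> \oo] --> (0 : X) by exact: cvg_series_cvg_0.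
have lim1 : series u n - G h (series u n) + u n @[n --> \oo] --> y - G h y + 0.
  apply: cvgD u0; apply: cvgB => //.
  exact: cvg_comp cu (@sg_continuous _ _ _ hN hG h (ltW h0) y).
move: lim1; rewrite addr0; under eq_fun do rewrite Gs.
move/cvg_unique; apply; first exact: norm_hausdorff.
exact: cvg_cst.
Qed.

(** [y - G (k h) y] is the telescoping sum of the [h G (j h) x] for [j < k],
    and each term is close to [h x]. *)
Lemma discrete_resolvent_iter (h e : R) x y k : 0 < h ->
  y - G h y = h *: x ->
  (forall s, 0 <= s <= k%:R * h -> N (G s x - x) <= e) ->
  N (y - G (k%:R * h) y - (k%:R * h) *: x) <= k%:R * h * e.
Proof.
move=> h0 yh; have kh j : 0 <= j%:R * h by rewrite mulr_ge0// ltW.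
elim: k => [|k IHk] He.
  by rewrite mul0r (sg0 hG) scale0r subrr subr0 eqn0// mul0r.
have k1 : k.+1%:R * h = k%:R * h + h by rewrite -addn1 natrD mulrDl mul1r.
have -> : y - G (k.+1%:R * h) y - (k.+1%:R * h) *: x =
    (y - G (k%:R * h) y - (k%:R * h) *: x) + h *: (G (k%:R * h) x - x).
  rewrite scalerBr -linearZ/= -{1}yh linearB/= -(sgD hG) ?(ltW h0)// -k1.
  rewrite [in X in X *: _]k1 scalerDl.
  by rewrite [RHS]addrACA [y - _ + (_ - _)]addrA subrK -opprD.
apply: le_trans (eqn_triangle hN _ _) _.
rewrite k1 mulrDl lerD//.
  apply: IHk => s /andP[s0 sk]; apply: He; rewrite s0 k1.
  by apply: le_trans sk _; rewrite lerDl ltW.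
rewrite (eqnZ hN) ?(ltW h0)// ler_pM2l//; apply: He.
by rewrite kh k1 lerDl ltW.
Qed.

(** For the coarse mesh [t = k h], the vector [y - z] solves the equation of
    mesh [t] whose right-hand side is small by [discrete_resolvent_iter]. The
    factor [t] in that estimate cancels the [t^-1] of
    [discrete_resolvent_bound], leaving a bound of order [e] for [t <= 1]. *)
Lemma discrete_resolvent_refine (h e : R) x y z k : 0 < h ->
  y - G h y = h *: x -> z - G (k%:R * h) z = (k%:R * h) *: x ->
  (forall s, 0 <= s <= k%:R * h -> N (G s x - x) <= e) -> (0 < k)%N ->
  d * N (y - z) <= (1 + d * (k%:R * h)) * e.
Proof.
move=> h0 yh zh He k0.
have t0 : 0 < k%:R * h by rewrite mulr_gt0// ltr0n.
have := discrete_resolvent_iter h0 yh He.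
rewrite -zh; move: t0 zh => {He}; set t := _ * h => t0 zh.
have -> : y - G t y - (z - G t z) = (y - z) - G t (y - z).
  by rewrite [G t (y - z)]linearB/= !opprB addrACA [RHS]addrACA [- z - _]addrC.
move=> H; have := discrete_resolvent_bound (y - z) (ltW t0) => H2.
have dt : 0 < 1 + d * t by have := mulr_gt0 d0 t0; lra.
rewrite -(ler_pM2l t0).
have : (1 + d * t) * N (y - z - G t (y - z)) <= (1 + d * t) * (t * e).
  by rewrite ler_pM2l.
by move: H2; lra.
Qed.

Lemma near0_uniform x (e : R) : 0 < e ->
  exists2 r : R, 0 < r & forall s, 0 <= s <= r -> N (G s x - x) <= e.
Proof.
move=> e0; have [r /= r0 hr] := eqn_near hN e0 (sg_cvg0 hG (x:=x)).
exists (r / 2); first by rewrite divr_gt0.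
move=> s /andP[]; rewrite le_eqVlt => /predU1P[<- _|s0 sr].
  by rewrite (sg0 hG) subrr eqn0// ltW.
by apply: hr => //=; rewrite sub0r normrN gtr0_norm//; lra.
Qed.

(** The limit [y] is the integral of [G s x] over the half-line, hence
    [y - G t y] is its integral from 0 to [t]. Dyadic meshes refine each other,
    so [discrete_resolvent_refine] makes the discrete solutions a Cauchy
    sequence. The estimate passes to the limit along the multiples
    of the mesh just below [t]. *)
Lemma discrete_resolvent_limit x : exists y, forall t e : R, 0 < t ->
  (forall s, 0 <= s <= t -> N (G s x - x) <= e) ->
  N (y - G t y - t *: x) <= t * e.
Proof.
pose step (n : nat) : R := 2^-1 ^+ n.
have step0 n : 0 < step n by rewrite exprn_gt0.
have [Y hY] : {Y : nat -> X & forall n, Y n - G (step n) (Y n) = step n *: x}.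
  by apply: (@choice _ _ (fun n y => y - G (step n) y = step n *: x)) => n;
     exact: discrete_resolvent.
have cstep : step n @[n --> \oo] --> (0 : R).
  by apply: cvg_expr; rewrite ger0_norm ?invr_ge0// invf_lt1// ltr1n.
have small (r : R) : 0 < r -> \forall n \near \oo, step n <= r.
  move=> r0; move/cvgrPdist_le : cstep => /(_ _ r0); apply: filterS => n.
  by rewrite sub0r normrN gtr0_norm.
have cY : cvgn Y.
  apply/cauchy_cvgP/cauchy_exP => e e0.
  have c0 : 0 < d * e / (2 * (1 + d)).
    by rewrite divr_gt0 ?mulr_gt0// addr_gt0.
  have [r r0 hr] := near0_uniform x c0.
  have r1 : 0 < Num.min r 1 by rewrite lt_min r0 ltr01.
  have [n _ /(_ n (leqnn n))] := small _ r1.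
  rewrite le_min => /andP[nr n1].
  exists (Y n); exists n => // m /= nm.
  have mk : step n = (2 ^ (m - n))%:R * step m.
    rewrite /step natrX -{2}(subnK nm) exprD mulrA -exprMn divff// expr1n.
    by rewrite mul1r.
  have zh := hY n; rewrite mk in zh.
  have := discrete_resolvent_refine (step0 m) (hY m) zh.
  rewrite -mk => H; rewrite -ball_normE/= distrC.
  apply: (le_lt_trans (eqn_ge hN _)); rewrite -(ltr_pM2l d0).
  apply: (@le_lt_trans _ _ ((1 + d * step n) * (d * e / (2 * (1 + d))))).
    apply: H; last by rewrite expn_gt0.
    by move=> s /andP[s0 sn]; rewrite hr// s0 (le_trans sn).
  apply: (@le_lt_trans _ _ ((1 + d) * (d * e / (2 * (1 + d))))).
    by rewrite ler_pM2r// lerD2l -[leRHS]mulr1 ler_pM2l.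
  have -> : (1 + d) * (d * e / (2 * (1 + d))) = d * e / 2.
    by field; rewrite gt_eqF// addr_gt0.
  by rewrite ltr_pdivrMr// ltr_pMr ?mulr_gt0// ltr1n.
pose y := limn Y; exists y => t e t0 He.
have e0 : 0 <= e.
  have /He : 0 <= (0 : R) <= t by rewrite lexx ltW.
  exact: le_trans (eqn_ge0 hN _).
apply/ler_addgt0Pr => eta eta0.
have eta4 : 0 < eta / 4 by lra.
have [r r0 hr] := near0_uniform y eta4.
have c0 : 0 < eta / 4 / (N x + 1).
  by rewrite divr_gt0//; have := eqn_ge0 hN x; lra.
near \oo => n.
have nr : step n <= r by near: n; exact: small.
have nx : step n * N x <= eta / 4.
  have : step n <= eta / 4 / (N x + 1) by near: n; exact: small.
  have := eqn_ge0 hN x => Nx0; rewrite ler_pdivlMr; last lra.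
  by have := step0 n; lra.
have ny : N (Y n - y) <= eta / 4 by near: n; exact: (eqn_near hN eta4 cY).
(* [k * step n] is the last mesh point before [t]; the remainder [s] is below
   one mesh. *)
pose k := Num.truncn (t / step n).
have := truncn_itv (divr_ge0 (ltW t0) (ltW (step0 n))).
rewrite -/k ler_pdivlMr// ltr_pdivrMr// => /andP[kt tk].
have kn0 : 0 <= k%:R * step n by rewrite mulr_ge0// ltW.
pose s := t - k%:R * step n.
have s0 : 0 <= s by rewrite /s subr_ge0.
have sn : s <= step n.
  by move: tk; rewrite -addn1 natrD mulrDl mul1r /s; lra.
have ts : t = k%:R * step n + s by rewrite /s addrC subrK.
have -> : y - G t y - t *: x =
    (Y n - G (k%:R * step n) (Y n) - (k%:R * step n) *: x)
    - ((Y n - y) - G (k%:R * step n) (Y n - y))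
    - G (k%:R * step n) (G s y - y) - s *: x.
  rewrite [in LHS]ts (sgD hG)// scalerDl.
  rewrite [G _ (Y n - y)]linearB [G _ (G s y - y)]linearB/=.
  move: (G _ (G s y)) (G _ (Y n)) (G (k%:R * step n) y) => q a p.
  rewrite [Y n - a - _ - _]addrAC -[Y n - y - _]opprB opprK.
  rewrite -[a - p - _]addrA subrKA opprB addrCA [Y n + _]addrC subrK.
  rewrite [- p + y]addrC [y - p - _ - _]addrAC opprB.
  by rewrite [y - p + _]addrA subrK opprD [LHS]addrA.
have B1 := decay_contraction (Y n - y) kn0.
have B2 := decay_contraction (G s y - y) kn0.
have B3 : N (G s y - y) <= eta / 4 by apply: hr; rewrite s0 (le_trans sn).
have B4 : N (Y n - G (k%:R * step n) (Y n) - (k%:R * step n) *: x) <= t * e.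
  apply: (@le_trans _ _ (k%:R * step n * e)); last by rewrite ler_wpM2r.
  apply: discrete_resolvent_iter => // u /andP[u0 uk].
  by apply: He; rewrite u0 (le_trans uk).
have B5 : N (s *: x) <= eta / 4.
  by rewrite (eqnZ hN)// (le_trans _ nx)// ler_wpM2r// eqn_ge0.
move: B1 B2 B3 B4 B5.
set a := Y n - _ - _; set b := Y n - y; set c := G s y - y.
pose g := G (k%:R * step n).
have := eqn_triangleB hN (a - (b - g b) - g c) (s *: x).
have := eqn_triangleB hN (a - (b - g b)) (g c).
have := eqn_triangleB hN a (b - g b).
have := eqn_triangleB hN b (g b).
rewrite /g -/b in ny *; move: ny; lra.
Unshelve. all: by end_near. Qed.

Lemma generator_of_limit x y :
  (forall t e : R, 0 < t -> (forall s, 0 <= s <= t -> N (G s x - x) <= e) ->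
     N (y - G t y - t *: x) <= t * e) ->
  generator_rel G y (- x).
Proof.
move=> hy; apply/cvgrPdist_le => e e0; have [r r0 hr] := near0_uniform x e0.
near=> h; have h0 : 0 < h by near: h; exact: nbhs_right_gt.
have hr' : h <= r by near: h; exact: nbhs_right_le.
have : N (y - G h y - h *: x) <= h * e.
  by apply: hy => // s /andP[s0 sh]; rewrite hr// s0 (le_trans sh).
have -> : - x - h^-1 *: (G h y - y) = h^-1 *: (y - G h y - h *: x).
  rewrite [in RHS]scalerBr scalerA mulVf ?gt_eqF// scale1r addrC.
  by rewrite -scalerN opprB.
move=> H; apply: le_trans (eqn_ge hN _) _.
rewrite (eqnZ hN) ?invr_ge0 ?(ltW h0)//.
by rewrite mulrC ler_pdivrMr// mulrC.
Unshelve. all: by end_near. Qed.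

Lemma generator_surjective x : exists y, generator_rel G y x.
Proof.
have [y /generator_of_limit] := discrete_resolvent_limit (- x).
by rewrite opprK; exists y.
Qed.

(** With [y] as in [discrete_resolvent_limit], the vector [(y - G r y) / r] is
    the mean of [G s z] over the interval from 0 to [r]. *)
Lemma generator_dense z (e : R) : 0 < e ->
  exists u w, generator_rel G u w /\ N (u - z) <= e.
Proof.
move=> e0; have [y hy] := discrete_resolvent_limit z.
have [r r0 hr] := near0_uniform z e0.
have gy := generator_of_limit hy.
have gGy := generator_orbit hN hG (ltW r0) gy.
have gyG := generator_linear (a := -1) gGy gy.
(* [(r^-1 - 1) v + v = r^-1 v]. *)
have gu := generator_linear (a := r^-1 - 1) gyG gyG.
exists (r^-1 *: (y - G r y)); eexists; split.
  rewrite scalerBl scale1r subrK scaleN1r addrC in gu; exact: gu.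
have -> : r^-1 *: (y - G r y) - z = r^-1 *: (y - G r y - r *: z).
  by rewrite [RHS]scalerBr scalerA mulVf ?gt_eqF// scale1r.
by rewrite (eqnZ hN) ?invr_ge0 ?(ltW r0)// ler_pdivrMl// hy.
Qed.

End DecayingSemigroup.

(** * The adapted norm of a strongly continuous semigroup *)

(** Orbits are bounded on the compact interval from 0 to 1; the uniform
    boundedness principle makes the bound proportional to [`|x|]. *)
Lemma C0_bounded01 (T : R -> {linear X -> X}) : C0_semigroup T ->
  exists2 C : R, 1 <= C & forall t x, 0 <= t <= 1 -> `|T t x| <= C * `|x|.
Proof.
move=> [Tb T0 TD Tc].
pose F : set (X -> X) := [set (T t : X -> X) | t in `[0, 1]].
have ptwise : pointwise_bounded F.
  move=> x.
  have cx : {within `[0, 1], continuous (fun t : R => T t x)}.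
    apply: continuous_subspaceW (Tc x).
    by move=> t /=; rewrite !in_itv/= => /andP[-> _].
  have := compact_bounded (continuous_compact cx (@segment_compact _ 0 1)).
  move=> [M [_ /(_ (M + 1))]]; rewrite ltrDl ltr01 => /(_ isT) H.
  exists (M + 1) => f [t t01 <-]; apply: H.
  by exists t.
have lin f : F f -> bounded_fun_norm f /\ linear f.
  move=> [t /=]; rewrite in_itv/= => /andP[t0 _] <-; split; last exact: linearP.
  have [M TM] := Tb t t0; move=> r.
  exists (`|M| * `|r|) => x xr; apply: (le_trans (TM x)).
  apply: (@le_trans _ _ (`|M| * `|x|)); first by rewrite ler_wpM2r// ler_norm.
  by rewrite ler_wpM2l// (le_trans xr)// ler_norm.
have [M0 HM] := Banach_Steinhauss lin ptwise 1.
pose M := Num.max M0 1.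
exists M => [|t x t01]; first by rewrite /M le_max lexx orbT.
have [->|x0] := eqVneq x 0; first by rewrite linear0 normr0 mulr0.
have nx : 0 < `|x| by rewrite normr_gt0.
have : `|T t (`|x|^-1 *: x)| <= M0.
  apply: HM; first by exists t => //=; rewrite in_itv.
  by rewrite normrZ normfV normr_id mulVf ?gt_eqF.
rewrite linearZ/= normrZ normfV normr_id ler_pdivrMl// mulrC.
move=> /le_trans; apply.
by rewrite ler_pM2r// le_max lexx.
Qed.

(** Splitting [t] into unit steps gives the bound [C ^+ (n + 1)] with
    [n <= t], so the growth rate is [ln C]. *)
Lemma C0_exponential_bound (T : R -> {linear X -> X}) : C0_semigroup T ->
  exists M w : R, [/\ 0 < M, 0 <= w &
    forall t x, 0 <= t -> `|T t x| <= M * expR (w * t) * `|x|].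
Proof.
move=> hT; have [C C1 TC] := C0_bounded01 hT; have [_ T0 TD _] := hT.
have C0 : 0 < C by lra.
have iterb n : forall t x, 0 <= t <= n.+1%:R -> `|T t x| <= C * C ^+ n * `|x|.
  elim: n => [|n IHn] t x /andP[t0 tn].
    by rewrite expr0 mulr1 TC// t0.
  have CC : 0 <= C * C ^+ n by rewrite mulr_ge0 ?exprn_ge0// ltW.
  have [t1|t1] := leP t 1.
    apply: (le_trans (TC _ _ _)); rewrite ?t0// ler_wpM2r//.
    rewrite ler_peMr ?(ltW C0)//.
    exact: exprn_ege1.
  have -> : t = 1 + (t - 1) by rewrite addrC subrK.
  rewrite TD//; last lra.
  apply: (le_trans (TC _ _ _)); first by rewrite ler01 lexx.
  rewrite exprS -2!mulrA ler_pM2l// mulrA IHn//.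
  by move: tn; rewrite -[n.+2]addn1 natrD; lra.
exists C, (ln C); split => // [|t x t0]; first exact: ln_ge0.
have /andP[nt tn] := truncn_itv t0.
apply: (le_trans (iterb (Num.truncn t) _ _ _)); first by rewrite t0 ltW.
rewrite ler_wpM2r// ler_pM2l// -{1}(lnK C0) -expRM_natr ler_expR.
by rewrite ler_wpM2l// ln_ge0.
Qed.

(** [N x] is the supremum of [exp (- w s) |T s x|] over [s >= 0]. Replacing [x]
    by [T t x] shifts [s] to [s + t] and so costs the factor [exp (w t)]. *)
Lemma adapted_norm_exists (T : R -> {linear X -> X}) : C0_semigroup T ->
  exists N w, [/\ equivalent_norm N, 0 <= w & adapted_semigroup N w T].
Proof.
move=> hT; have [M [w [M0 w0 TM]]] := C0_exponential_bound hT.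
have [Tb T0 TD Tc] := hT.
pose E x := [set expR (- w * t) * `|T t x| | t in [set t | 0 <= t]].
pose N x := sup (E x).
have ubE x : ubound (E x) (M * `|x|).
  move=> _ [t /= t0 <-]; rewrite mulNr expRN ler_pdivrMl ?expR_gt0//.
  by rewrite mulrA [expR _ * M]mulrC TM.
have supE x : has_sup (E x).
  split; last by exists (M * `|x|); exact: ubE.
  by exists (expR (- w * 0) * `|T 0 x|); exists 0 => /=.
have le_N x t : 0 <= t -> expR (- w * t) * `|T t x| <= N x.
  by move=> t0; apply: sup_upper_bound => //; exists t.
have N_le x c :
    (forall t, 0 <= t -> expR (- w * t) * `|T t x| <= c) -> N x <= c.
  move=> H; apply: ge_sup; first by have [] := supE x.
  by move=> _ [t t0 <-]; exact: H.
have N_scale (a : R) x : N (a *: x) <= `|a| * N x.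
  apply: N_le => t t0; rewrite linearZ/= normrZ mulrCA ler_wpM2l//.
  exact: le_N.
exists N, w; split => //.
- split=> [x y|a x|x|].
  + apply: N_le => t t0; rewrite linearD/=.
    apply: (@le_trans _ _ (expR (- w * t) * (`|T t x| + `|T t y|))).
      by rewrite ler_pM2l ?expR_gt0// ler_normD.
    by rewrite mulrDr lerD// le_N.
  + apply/eqP; rewrite eq_le N_scale/=.
    have [->|a0] := eqVneq a 0.
      rewrite normr0 mul0r; apply: (le_trans _ (le_N _ 0 (lexx _))).
      by rewrite mulr_ge0 ?expR_ge0.
    rewrite -ler_pdivlMl ?normr_gt0// -normfV.
    by rewrite -{1}[x]scale1r -(mulVf a0) -scalerA N_scale.
  + by have := le_N x 0 (lexx _); rewrite mulr0 expR0 mul1r T0.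
  + exists M => // x; apply: N_le => t t0.
    by apply: ubE; exists t.
- split=> // [x|t x t0].
  + have /continuous_within_itvcyP[_] := Tc x.
    by rewrite T0.
  + apply: N_le => s s0; rewrite -TD//.
    have := le_N x (s + t) (addr_ge0 s0 t0).
    rewrite mulrDr expRD !mulNr !expRN => H.
    rewrite [expR (w * t) * _]mulrC -ler_pdivrMr ?expR_gt0//.
    by rewrite mulrAC.
Qed.

(** * Dissipativity with respect to a total set *)

(** Dissipativity is used at [- y]. The functional [psi] obtained there is
    positive and attains [p_phi (- y)], which dominates [phi (- y)]. *)
Lemma dissipative_positive (K : set X) (A : operator X)
    (Phi : set {linear X -> R^o}) (a b : R) y :
  total_functionals K Phi ->
  (forall phi, Phi phi -> dissipative K (p_fun K phi) A) ->
  0 < a -> 0 <= b -> op_dom A y -> K (a *: y - b *: A y) -> K y.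
Proof.
move=> [_ Phisub tot] hd a0 b0 Ay Kz.
suff : cone_le K 0 y by rewrite /cone_le subr0.
apply: tot => phi Pphi.
have ANy : op_dom A (- y).
  have := op_domP (-1) Ay (op_dom0 A); by rewrite scaleN1r addr0.
have A0 : A 0 = 0.
  have := op_linear (-1) (op_dom0 A) (op_dom0 A).
  by rewrite scaler0 addr0 scaleN1r addNr.
have ANyE : A (- y) = - A y.
  have := op_linear (-1) Ay (op_dom0 A).
  by rewrite scaleN1r addr0 A0 scaleN1r addr0.
have [psi [[_ psi0] psi_le psiE] psiA] := hd phi Pphi (- y) ANy.
have psiz : 0 <= psi (a *: y - b *: A y).
  by apply: psi0; rewrite /cone_le subr0.
move: psiA; rewrite ANyE linearN oppr_le0 => psiA.
have psiy : 0 <= (psi y : R).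
  have E : psi (a *: y - b *: A y) = a * (psi y : R) - b * (psi (A y) : R).
    by rewrite [LHS]linearB [psi (a *: y)]linearZ [psi (b *: _)]linearZ.
  have := mulr_ge0 b0 psiA; move: psiz; rewrite E => H1 H2.
  by rewrite -(pmulr_rge0 _ a0); lra.
have : ((phi (- y) : R)%:E <= (psi (- y) : R)%:E)%E.
  rewrite psiE; apply: le_ereal_inf_tmp => _ [u [Ku yu] <-].
  have [_ phi0] := Phisub phi Pphi.
  have := phi0 (u - - y); rewrite /cone_le subr0 => /(_ yu).
  by rewrite linearB subr_ge0 lee_fin.
by rewrite lee_fin !linearN lerN2; exact: le_trans.
Qed.

Lemma total_closed (K : set X) (Phi : set {linear X -> R^o}) :
  total_functionals K Phi -> closed K.
Proof.
move=> [_ Phisub tot].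
have -> : K = \bigcap_(phi in Phi) [set x | 0 <= (phi x : R)].
  apply/seteqP; split => [x Kx phi /Phisub[_ phi0]|x Kx].
    by apply: phi0; rewrite /cone_le subr0.
  suff : cone_le K 0 x by rewrite /cone_le subr0.
  exact: tot.
apply: closed_bigI => phi /Phisub[phic _].
apply: (@preimage_closed _ _ phi [set r | 0 <= r]); last exact: closed_ge.
by move=> x _; exact: phic.
Qed.

Lemma generator_opP (A : operator X) T x y : is_generator A T ->
  generator_rel T x y -> op_dom A x /\ A x = y.
Proof.
move=> [Ad Av] gx.
have Ax : op_dom A x by rewrite Ad /=; apply: cvgP gx.
split => //; apply: cvg_unique (Av x Ax) gx; exact: norm_hausdorff.
Qed.

End Semigroups.

Theorem theorem4p5 (R : realType) (X : completeNormedModType R) (K : set X)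
    (hK : is_cone K) (A : operator X) (T : R -> {linear X -> X})
    (hT : C0_semigroup T) (hA : is_generator A T)
    (hdiss : exists Phi : set {linear X -> R^o},
       total_functionals K Phi /\
       forall phi : {linear X -> R^o}, Phi phi -> dissipative K (p_fun K phi) A)
    (hinv : exists lambda : R, 0 <= lambda /\ invertible_id_sub A lambda) :
  forall t : R, 0 <= t -> positive_op K (T t).
Proof.
have [Phi [tot diss]] := hdiss.
have [N [w [hN w0 hTN]]] := adapted_norm_exists hT.
pose S := rescale w T.
have hS : adapted_semigroup N 0 S.
  by rewrite -(subrr w); exact: rescale_adapted.
(* The domain and the resolvents of the generator of [S] are found from a
   further rescaling, which decays. *)
have hG (a : R) : adapted_semigroup N (- a) (rescale a S).
  by rewrite -[- a]add0r; exact: rescale_adapted.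
have dense z (e : R) : 0 < e ->
    exists u v, generator_rel S u v /\ N (u - z) <= e.
  move=> e0.
  have [u [v [/generator_unrescale gu uz]]] :=
    generator_dense hN ltr01 (hG 1) z e0.
  by exists u; eexists; split; [exact: gu|].
have resolvent_pos (h : R) z : 0 < h ->
    exists u v, [/\ generator_rel S u v, u - h *: v = z & (K z -> K u)].
  move=> h0; have ih0 : 0 < h^-1 by rewrite invr_gt0.
  have [u /generator_unrescale gu] :=
    generator_surjective hN ih0 (hG _) (- (h^-1 *: z)).
  have uz : u - h *: (- (h^-1 *: z) + h^-1 *: u) = z.
    rewrite scalerDr scalerN !scalerA divff ?gt_eqF// !scale1r.
    by rewrite opprD opprK addrCA subrr addr0.
  exists u; eexists; split; [exact: gu|exact: uz|move=> Kz].
  (* [u - h v = (1 + h w) u - h A u], because [A - w] generates [S]. *)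
  have [Au AuE] := generator_opP hA (generator_unrescale gu).
  have hw : 0 < 1 + h * w by have := mulr_ge0 (ltW h0) w0; lra.
  apply: (dissipative_positive tot diss hw (ltW h0) Au).
  rewrite AuE scalerDr opprD addrCA scalerA addrC scalerDl scale1r addrK addrC.
  by rewrite addrC uz.
move=> t t0 x; rewrite /cone_le !subr0 => Kx.
have KS : K (S t x).
  exact: (resolvent_invariant hN hS (total_closed tot) dense resolvent_pos).
have -> : T t x = expR (w * t) *: S t x + 0 *: S t x.
  rewrite scale0r addr0 /S /rescale/= scalerA -expRD -mulrDl subrr mul0r.
  by rewrite expR0 scale1r.
by apply: hK.1 => //; exact: expR_ge0.
Qed.
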